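(* Let $k \geq 2$ be an even integer and let $q$ be a prime power such that $q \equiv k+1 \pmod{2k}$. Let $m \geq k$ be an integer. If $P_k(q)$ contains no monochromatic transitive subtournament of order $m$, then $M_k^{\ast}(q)$ (for any choice of the reassigned colors and orientations in its construction) contains no monochromatic transitive subtournament of order $m+2$.
   Context: A tournament is a digraph in which every pair of distinct vertices is joined by exactly one oriented edge (no loops); it is transitive if, whenever $a \to b$ and $b \to c$, then $a \to c$. A subtournament of an edge-colored tournament is monochromatic if all its edges have the same color. The order is the number of vertices. Let $\mathbb{F}_q$ be the finite field with $q$ elements, $\omega$ a fixed primitive element of $\mathbb{F}_q$, and $S_k = \langle \omega^k \rangle$ the subgroup of $\mathbb{F}_q^{\ast}$ of order $\frac{q-1}{k}$ consisting of the $k$-th power residues. Put $S_{k,0} := \{0\}$ and $S_{k,i} := \omega^{i-1} S_k$ for $1 \leq i \leq \frac{k}{2}$. Since $q \equiv k+1 \pmod{2k}$, $\mathbb{F}_q$ is the disjoint union of $S_{k,0}$, the sets $S_{k,i}$ and the sets $-S_{k,i}$, $1 \leq i \leq \frac{k}{2}$. The multicolor $k$-th power Paley tournament $P_k(q)$ is the tournament with vertex set $\mathbb{F}_q$ whose edges are colored in $\frac{k}{2}$ colors: $a \to b$ is an edge of color $i$ ($1 \leq i \leq \frac{k}{2}$) if and only if $b - a \in S_{k,i}$. Let $X := (\mathbb{F}_q \times \mathbb{F}_q) \setminus \{(0,0)\}$, with the equivalence relation $(a,b) \sim (c,d)$ iff $(c,d) = (ag,bg)$ for some $g \in S_k$;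 write $[a,b]$ for the class of $(a,b)$. There are $k(q+1)$ classes. $M_k(q)$ is the edge-colored digraph (without loops) with vertex set $X/\sim$, in which, for distinct vertices, $[a,b] \to [c,d]$ is an edge in color $i$, $0 \leq i \leq \frac{k}{2}$, if and only if $bc - ad \in S_{k,i}$. (This is well defined. Any two distinct vertices are either connected by a single oriented edge in some color $i$ with $1 \leq i \leq \frac{k}{2}$, or connected by two edges of color $0$ oriented in opposite directions.) $M_k^{\ast}(q)$ denotes a graph obtained from $M_k(q)$ by replacing each pair of oppositely oriented color $0$ edges between two vertices with a single oriented edge of some color $i$ with $1 \leq i \leq \frac{k}{2}$, where the new color and orientation are assigned arbitrarily, independently for each such pair. It is a tournament of order $k(q+1)$ whose edges are colored in $\frac{k}{2}$ colors. *)

(* Defs.v *)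
From HB Require Import structures.
From mathcomp Require Import all_boot all_order all_algebra all_fingroup all_solvable.

Set Implicit Arguments.
Unset Strict Implicit.
Unset Printing Implicit Defensive.

Import GRing.Theory.
Local Open Scope ring_scope.

(* [D i x y] means that there is an edge x -> y of color i. *)
Definition colored_digraph (C V : finType) := C -> rel V.

Section ColoredDigraph.

Variables (C V : finType) (D : colored_digraph C V).

Definition edge (x y : V) : bool := [exists i, D i x y].

(* The subdigraph induced on A is a tournament, each edge of which carries
   exactly one color. *)
Definition tournament_on (A : {set V}) : Prop :=
  [/\ forall x, x \in A -> ~~ edge x x,
      forall x y, x \in A -> y \in A -> x != y -> edge x y (+) edge y x
    & forall i j x y, x \in A -> y \in A -> D i x y -> D j x y -> i = j].

Definition transitive_on (A : {set V}) : Prop :=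
  {in A & &, forall x y z, edge x y -> edge y z -> edge x z}.

Definition monochromatic_on (A : {set V}) : Prop :=
  exists i, forall j x y, x \in A -> y \in A -> D j x y -> j = i.

Definition has_mono_trans_subtournament (m : nat) : Prop :=
  exists A : {set V},
    [/\ #|A| = m, tournament_on A, monochromatic_on A & transitive_on A].

End ColoredDigraph.

(* Colors 0, 1, ..., k/2; color 0 occurs only in M_k(q). *)
Definition color (k : nat) : finType := 'I_(k./2).+1.

Section PowerResidues.

Variables (F : finFieldType) (k : nat) (w : {unit F}).

(* S_k, as a subgroup of the multiplicative group of F. *)
Definition power_residues : {group {unit F}} := <[w ^+ k]>%G.

(* S_{k,i} *)
Definition power_class (i : nat) : {set F} :=
  if i is j.+1 then [set FinRing.uval w ^+ j * FinRing.uval g | g in power_residues]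
  else [set 0].

(* P_k(q) *)
Definition paley : colored_digraph (color k) F :=
  fun i a b => (0 < i)%N && (b - a \in power_class i).

Definition nonzero_pairs : {set F * F} := [set~ (0, 0)].

Definition pair_equiv : rel (F * F) := fun x y =>
  [exists g in power_residues,
     y == (x.1 * FinRing.uval g, x.2 * FinRing.uval g)].

Definition pair_class : finType :=
  {B : {set F * F} | B \in equivalence_partition pair_equiv nonzero_pairs}.

(* M_k(q); by [Mgraph_repr] below, the choice of representatives (a,b) and (c,d)
   is immaterial. *)
Definition Mgraph : colored_digraph (color k) pair_class :=
  fun i u v => (u != v) &&
    [exists x in val u, exists y in val v,
       x.2 * y.1 - x.1 * y.2 \in power_class i].

(* T is one of the graphs M_k^*(q). *)
Definition is_Mstar (T : colored_digraph (color k) pair_class) : Prop :=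
  (forall u v, ~~ Mgraph ord0 u v -> forall i, T i u v = Mgraph i u v) /\
  (forall u v, Mgraph ord0 u v ->
     exists2 i : color k, (0 < i)%N &
       (forall j, T j u v = (j == i) /\ T j v u = false) \/
       (forall j, T j v u = (j == i) /\ T j u v = false)).

Lemma power_classM i (g : {unit F}) (x : F) :
  g \in power_residues -> x \in power_class i ->
  x * FinRing.uval g \in power_class i.
Proof.
case: i => [|j] gS /=; first by rewrite !inE => /eqP->; rewrite mul0r.
case/imsetP=> h hS ->; apply/imsetP; exists (h * g)%g; first by rewrite groupM.
by rewrite /= mulrA.
Qed.

Lemma pair_equivP :
  {in nonzero_pairs & &, equivalence_rel pair_equiv}.
Proof.
move=> x y z _ _ _; split.
  by apply/exists_inP; exists 1%g; rewrite ?group1 //= !mulr1 -surjective_pairing.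
case/exists_inP=> g gS /eqP->; apply/exists_inP/exists_inP => -[h hS /eqP->].
  exists (g^-1 * h)%g; first by rewrite groupM ?groupV.
  by rewrite /= !mulrA !mulrK // (valP g).
by exists (g * h)%g; rewrite ?groupM //= !mulrA.
Qed.

Lemma pair_class_equiv (u : pair_class) x y :
  x \in val u -> y \in val u -> pair_equiv x y.
Proof.
case: u => B /= /imsetP[z zX ->]; rewrite !inE => /andP[xX zx] /andP[yX zy].
have xE : x \in nonzero_pairs by rewrite !inE.
have yE : y \in nonzero_pairs by rewrite !inE.
by rewrite -((pair_equivP zX xE yE).2 zx).
Qed.

Lemma Mgraph_repr (i : color k) (u v : pair_class) x y :
  x \in val u -> y \in val v ->
  Mgraph i u v = (u != v) && (x.2 * y.1 - x.1 * y.2 \in power_class i).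
Proof.
move=> xu yv; rewrite /Mgraph; congr (_ && _); apply/idP/idP; last first.
  by move=> xyS; apply/exists_inP; exists x => //; apply/exists_inP; exists y.
case/exists_inP=> x' x'u /exists_inP[y' y'v xyS].
have /exists_inP[g gS /eqP->] := pair_class_equiv x'u xu.
have /exists_inP[h hS /eqP->] := pair_class_equiv y'v yv.
have := power_classM hS (power_classM gS xyS).
suff -> : (x'.2 * y'.1 - x'.1 * y'.2) * FinRing.uval g * FinRing.uval h =
  x'.2 * FinRing.uval g * (y'.1 * FinRing.uval h) -
  x'.1 * FinRing.uval g * (y'.2 * FinRing.uval h) by [].
by rewrite !mulrBl -!mulrA ![FinRing.uval g * (_ * _)]mulrCA.
Qed.

End PowerResidues.

Arguments paley {F} k w _ _ _.
Arguments pair_class {F} k w.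
Arguments Mgraph {F} k w _ _ _.
Arguments is_Mstar {F} k w T.

(* Main.v *)
Require Import Defs.
From mathcomp Require Import all_boot all_order all_algebra all_fingroup all_solvable.
From mathcomp Require Import ring.

Set Implicit Arguments.
Unset Strict Implicit.
Unset Printing Implicit Defensive.

Import GRing.Theory.
Local Open Scope ring_scope.

(** Write [x, y] for [x.2 * y.1 - x.1 * y.2], the determinant that colors
M_k(q), and call two vertices parallel when it vanishes on their
representatives; the distinct parallel vertices are exactly the pairs whose
edges get reassigned.

Fix a vertex v and a color i > 0.  The vertices u with an edge v -> u of color
i in M_k(q) have a representative with [v, u] = w^(i-1), so that they are
parametrized by an affine line, on which the determinant is a difference of
coordinates: the out-neighborhood of v in color i is a copy of the Paley
tournament P_k(q) ([Mgraph_out_paley]).  In particular no two of its vertices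
are parallel, and likewise for in-neighborhoods ([parallel_out_inj],
[parallel_in_inj]).

Let A be a monochromatic transitive subtournament of order m + 2 of M_k^*(q),
with source v.  A class of parallel vertices has at most k < m + 2 elements
([card_parallel]), so A has a vertex u that is not parallel to v.  If A had two
further vertices parallel to v, two of these three parallel vertices would be
on the same side of u, which was just excluded ([card_parallel_mono]).  So at
least m vertices of A are not parallel to v; since v is the source, they are
out-neighbors of v in M_k(q), and therefore span a copy of a subtournament of
P_k(q). *)

(** * Transitive tournaments *)

Section Tournaments.

Variables (C V : finType) (D : colored_digraph C V).

(** A vertex with the most out-neighbors in A is a source: an in-neighbor of it
would, by transitivity, have strictly more. *)
Lemma transitive_source (A : {set V}) :
  A != set0 -> tournament_on D A -> transitive_on D A ->
  exists2 v, v \in A & {in A, forall u, u != v -> edge D v u}.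
Proof.
case/set0Pn=> a aA [irr tot _] tr.
case: (@arg_maxnP V a (mem A) (fun v => #|[set u in A | edge D v u]|) aA).
move=> v /= vA vmax; exists v => // u uA uv.
have := tot v u vA uA; rewrite eq_sym uv => /(_ isT).
case: (boolP (edge D v u)) => //= _ euv.
have /= := vmax u uA; rewrite /geq /= leqNgt => /negP[]; apply: proper_card.
apply/properP; split.
  apply/subsetP=> z; rewrite !inE => /andP[zA evz]; rewrite zA.
  exact: tr euv evz.
by exists v; rewrite !inE vA //= (irr v vA).
Qed.

(** Since f preserves the absence of edges as well, the orientation and the unique
color of each edge carry over from B to its image. *)
Lemma mono_trans_embedding (V' : finType) (D' : colored_digraph C V')
    (f : V -> V') (A B : {set V}) :
  {subset B <= A} -> {in B &, injective f} ->
  {in B &, forall x y j, D' j (f x) (f y) = D j x y} ->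
  tournament_on D A -> monochromatic_on D A -> transitive_on D A ->
  has_mono_trans_subtournament D' #|B|.
Proof.
move=> sBA f_inj DE [irr tot uniqc] [i mono] tr.
have edgeE : {in B &, forall x y, edge D' (f x) (f y) = edge D x y}.
  by move=> x y xB yB; apply: eq_existsb => j; apply: DE.
exists (f @: B); split; first exact: card_in_imset.
- split.
  + by move=> _ /imsetP[x xB ->]; rewrite edgeE ?irr ?sBA.
  + move=> _ _ /imsetP[x xB ->] /imsetP[y yB ->] fxy; rewrite !edgeE //.
    by apply: tot; rewrite ?sBA //; apply: contraNneq fxy => ->.
  + move=> j j' _ _ /imsetP[x xB ->] /imsetP[y yB ->]; rewrite !DE //.
    by apply: uniqc; rewrite sBA.
- exists i => j _ _ /imsetP[x xB ->] /imsetP[y yB ->]; rewrite DE //.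
  by apply: mono; rewrite sBA.
- move=> _ _ _ /imsetP[x xB ->] /imsetP[y yB ->] /imsetP[z zB ->].
  by rewrite !edgeE //; apply: tr; rewrite sBA.
Qed.

End Tournaments.

(** * The determinant of two pairs *)

Section Cross.

Variable F : finFieldType.
Implicit Types x y z e : F * F.

Definition cross x y : F := x.2 * y.1 - x.1 * y.2.

Lemma cross_jacobi x y z :
  cross y z * x.1 + cross z x * y.1 + cross x y * z.1 = 0 /\
  cross y z * x.2 + cross z x * y.2 + cross x y * z.2 = 0.
Proof. by rewrite /cross; split; ring. Qed.

Lemma crossC x y : cross y x = - cross x y.
Proof. by rewrite /cross; ring. Qed.

Lemma cross_plucker x y z e :
  cross y z * cross x e = cross x y * cross e z - cross x z * cross e y.
Proof. by rewrite /cross; ring. Qed.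

Lemma crossZr x y c : cross x (y.1 * c, y.2 * c) = cross x y * c.
Proof. by rewrite /cross /=; ring. Qed.

Lemma crossZl x y c : cross (x.1 * c, x.2 * c) y = cross x y * c.
Proof. by rewrite /cross /=; ring. Qed.

(** For fixed nonzero y, [cross_jacobi] with two vanishing coefficients says that
[x, z] kills y. *)
Lemma cross_eq0_trans x y z :
  y != 0 -> cross x y = 0 -> cross y z = 0 -> cross x z = 0.
Proof.
move=> y0 xy yz; have [] := cross_jacobi x y z.
rewrite xy yz !mul0r !add0r !addr0 (crossC x z) => /eqP + /eqP.
rewrite !mulf_eq0 oppr_eq0; case: eqP => //= _ /eqP y1 /eqP y2.
by case: y y0 y1 y2 {xy yz} => a b /= + a0 b0; rewrite a0 b0 eqxx.
Qed.

(** The line of all x with [z, x] = s misses the origin when s is nonzero, so it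
meets each line through the origin at most once. *)
Lemma cross_eq0_inj z x y (s : F) :
  s != 0 -> cross z x = s -> cross z y = s -> cross x y = 0 -> x = y.
Proof.
move=> s0 zx zy xy; have [] := cross_jacobi x y z.
rewrite (crossC z y) zx zy xy !mul0r !addr0 !mulNr ![- _ + _]addrC.
rewrite -!mulrBr => /eqP + /eqP; rewrite !mulf_eq0 (negPf s0) /= !subr_eq0.
by case: x y {zx zy xy} => [a b] [c d] /= /eqP-> /eqP->.
Qed.

Lemma cross_basis x : x != 0 -> exists e, cross x e = 1.
Proof.
case: x => a b; case: (eqVneq b 0) => [->|b0] ab0.
  have a0 : a != 0 by apply: contraNneq ab0 => ->.
  by exists (0, - a^-1); rewrite /cross /= mul0r sub0r mulrN opprK divff.
by exists (b^-1, 0); rewrite /cross /= mulr0 subr0 divff.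
Qed.

Lemma cross_eq0_colinear x y :
  x != 0 -> cross x y = 0 -> exists c, y = (x.1 * c, x.2 * c).
Proof.
move=> /cross_basis[e xe] xy; exists (cross y e).
have [] := cross_jacobi x y e.
rewrite (crossC x e) xe xy !mul0r !addr0 !mulN1r => /eqP + /eqP.
rewrite !subr_eq0 ![_ * cross y e]mulrC.
by case: y {xy} => c d /= /eqP-> /eqP->.
Qed.

End Cross.

(** * Vertices of M_k(q) and their parallel classes *)

Section Mgraph.

Variables (F : finFieldType) (k : nat) (w : {unit F}).
Implicit Types (u v t : pair_class k w) (x y : F * F).
Local Notation uval := (@FinRing.uval F).

Lemma pair_class_partition :
  partition (equivalence_partition (pair_equiv k w) (nonzero_pairs F))
            (nonzero_pairs F).
Proof. exact/equivalence_partitionP/pair_equivP. Qed.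

Lemma pair_class_neq0 u x : x \in val u -> x != 0.
Proof.
case: u => B BP /= xB; have /and3P[/eqP cov _ _] := pair_class_partition.
have : x \in nonzero_pairs F by rewrite -cov; apply/bigcupP; exists B.
by rewrite !inE.
Qed.

Lemma pair_class_repr u : exists x, x \in val u.
Proof.
case: u => B BP /=; have /and3P[_ _ n0] := pair_class_partition.
by apply/set0Pn; apply: contraNneq n0 => <-.
Qed.

Lemma pair_class_eq u v x : x \in val u -> x \in val v -> u = v.
Proof.
move=> xu xv; apply: val_inj; have /and3P[_ tr _] := pair_class_partition.
by rewrite -(def_pblock tr (valP u) xu) -(def_pblock tr (valP v) xv).
Qed.

Lemma pair_class_scale u x g :
  x \in val u -> g \in power_residues k w ->
  (x.1 * uval g, x.2 * uval g) \in val u.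
Proof.
move=> xu gS; have x0 := pair_class_neq0 xu.
set y := (_, _); have y0 : y \in nonzero_pairs F.
  rewrite !inE; apply: contraNneq x0 => -[/eqP a /eqP b]; move: a b.
  have g0 : uval g != 0 by rewrite -unitfE (valP g).
  by rewrite !mulf_eq0 (negPf g0) !orbF; case: x {xu y} => ? ? /= /eqP-> /eqP->.
have xn : x \in nonzero_pairs F by rewrite !inE.
have xy : pair_equiv k w x y by apply/exists_inP; exists g.
case: u xu => B BP /= xB; have /and3P[_ tr _] := pair_class_partition.
rewrite -(def_pblock tr BP xB).
by rewrite (@pblock_equivalence_partition _ _ _ (@pair_equivP F k w)).
Qed.

Lemma Mgraph0E u v x y :
  x \in val u -> y \in val v ->
  Mgraph k w ord0 u v = (u != v) && (cross x y == 0).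
Proof. by move=> xu yv; rewrite (Mgraph_repr _ xu yv) inE. Qed.

Lemma MgraphE (i : color k) u v x y :
  x \in val u -> y \in val v ->
  Mgraph k w i u v = (u != v) && (cross x y \in power_class k w i).
Proof. exact: Mgraph_repr. Qed.

Definition parallel u v : bool := (u == v) || Mgraph k w ord0 u v.

Lemma parallelE u v x y :
  x \in val u -> y \in val v -> parallel u v = (cross x y == 0).
Proof.
move=> xu yv; rewrite /parallel (Mgraph0E xu yv); case: (eqVneq u v) => //= uv.
rewrite uv in xu; have /exists_inP[g gS /eqP->] := pair_class_equiv xu yv.
by rewrite crossZr; apply/esym/eqP; rewrite /cross; ring.
Qed.

Lemma parallelC u v : parallel u v = parallel v u.
Proof.
have [[x xu] [y yv]] := (pair_class_repr u, pair_class_repr v).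
by rewrite (parallelE xu yv) (parallelE yv xu) crossC oppr_eq0.
Qed.

Lemma parallel_trans v u t : parallel u v -> parallel v t -> parallel u t.
Proof.
have [x xu] := pair_class_repr u; have [y yv] := pair_class_repr v.
have [z zt] := pair_class_repr t.
rewrite (parallelE xu yv) (parallelE yv zt) (parallelE xu zt) => /eqP xy /eqP yz.
by rewrite (cross_eq0_trans (pair_class_neq0 yv) xy yz).
Qed.

(** If w generates the multiplicative group, every coset of the k-th powers is
represented by some w ^+ j, j < k, so a class of parallel vertices is
covered by the k vertices [x w^j]. *)
Lemma card_parallel v :
  (0 < k)%N -> generator [set: {unit F}] w ->
  (#|[set u | parallel v u]| <= k)%N.
Proof.
move=> k0 /eqP w_gen; have [x xv] := pair_class_repr v.
pose scaled (j : 'I_k) := (x.1 * uval (w ^+ j)%g, x.2 * uval (w ^+ j)%g).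
pose h j := odflt v [pick u : pair_class k w | scaled j \in val u].
rewrite -[leqRHS]card_ord; apply: leq_trans (leq_imset_card h predT).
apply: subset_leq_card; apply/subsetP=> u; rewrite inE.
have [y yu] := pair_class_repr u; rewrite (parallelE xv yu) => /eqP xy.
have [c yE] := cross_eq0_colinear (pair_class_neq0 xv) xy.
have c0 : c \is a GRing.unit.
  rewrite unitfE; apply: contraTneq (pair_class_neq0 yu) => c0.
  by rewrite yE c0 !mulr0 eqxx.
have : FinRing.unit F c0 \in <[w]>%g by rewrite -w_gen inE.
case/cycleP=> n /(congr1 uval) /= cE.
apply/imsetP; exists (Ordinal (ltn_pmod n k0)) => //.
have uj : scaled (Ordinal (ltn_pmod n k0)) \in val u.
  have wE : (w ^+ (n %% k) = w ^+ n * ((w ^+ k) ^+ (n %/ k))^-1)%g.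
    by apply: canRL (mulgK _) _; rewrite -expgM -expgD addnC mulnC -divn_eq.
  have := pair_class_scale yu (groupVr (mem_cycle (w ^+ k)%g (n %/ k))).
  by rewrite yE /= -!mulrA cE /scaled wE.
rewrite /h; case: pickP => [t tj|/(_ u)] /=; first exact: pair_class_eq uj tj.
by rewrite uj.
Qed.

(** * Neighborhoods in M_k(q) *)

Lemma power_class_normalize (i : nat) (c : F) :
  (0 < i)%N -> c \in power_class k w i ->
  exists2 g, g \in power_residues k w & c * uval g = uval w ^+ i.-1.
Proof.
case: i => // i _ /imsetP[g gS ->]; exists g^-1%g; first by rewrite groupV.
by rewrite /= -mulrA divrr ?mulr1 // (valP g).
Qed.

Lemma power_class_neq0 (i : nat) : (0 < i)%N -> 0 \notin power_class k w i.
Proof.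
move=> i0; apply/negP => /(power_class_normalize i0)[g _] /esym/eqP.
by rewrite mul0r expf_eq0 -[_ == 0]negbK -unitfE (valP w) andbF.
Qed.

Lemma Mgraph_normalize_out (i : color k) u v x :
  (0 < i)%N -> x \in val v -> Mgraph k w i v u ->
  exists2 y, y \in val u & cross x y = uval w ^+ i.-1.
Proof.
move=> i0 xv; have [y yu] := pair_class_repr u.
rewrite (MgraphE _ xv yu) => /andP[_ /(power_class_normalize i0)[g gS gE]].
exists (y.1 * uval g, y.2 * uval g); first exact: pair_class_scale.
by rewrite crossZr.
Qed.

Lemma Mgraph_normalize_in (i : color k) u v x :
  (0 < i)%N -> x \in val v -> Mgraph k w i u v ->
  exists2 y, y \in val u & cross y x = uval w ^+ i.-1.
Proof.
move=> i0 xv; have [y yu] := pair_class_repr u.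
rewrite (MgraphE _ yu xv) => /andP[_ /(power_class_normalize i0)[g gS gE]].
exists (y.1 * uval g, y.2 * uval g); first exact: pair_class_scale.
by rewrite crossZl.
Qed.

Lemma uvalX_neq0 n : uval w ^+ n != 0.
Proof. by rewrite expf_neq0 // -unitfE (valP w). Qed.

(** Normalized to the same value of [z, _], parallel representatives agree. *)
Lemma parallel_out_inj (i : color k) v u t :
  (0 < i)%N -> Mgraph k w i v u -> Mgraph k w i v t -> parallel u t -> u = t.
Proof.
move=> i0 vu vt; have [z zv] := pair_class_repr v.
have [x xu xE] := Mgraph_normalize_out i0 zv vu.
have [y yt yE] := Mgraph_normalize_out i0 zv vt.
rewrite (parallelE xu yt) => /eqP xy.
apply: (pair_class_eq xu).
by rewrite (cross_eq0_inj (uvalX_neq0 _) xE yE xy).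
Qed.

Lemma parallel_in_inj (i : color k) v u t :
  (0 < i)%N -> Mgraph k w i u v -> Mgraph k w i t v -> parallel u t -> u = t.
Proof.
move=> i0 uv tv; have [z zv] := pair_class_repr v.
have [x xu xE] := Mgraph_normalize_in i0 zv uv.
have [y yt yE] := Mgraph_normalize_in i0 zv tv.
rewrite (parallelE xu yt) => /eqP xy.
apply: (pair_class_eq xu).
rewrite (@cross_eq0_inj _ z x y (- uval w ^+ i.-1) _ _ _ xy) //.
- by rewrite oppr_eq0 uvalX_neq0.
- by rewrite crossC xE.
- by rewrite crossC yE.
Qed.

(** Take x in v and e with [x, e] = 1.  If y and z represent out-neighbors of v
and [x, y] = [x, z] = s, then the Pluecker relation reads
[y, z] = s [e, z] - s [e, y]; hence f is s [e, _] on such representatives. *)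
Lemma Mgraph_out_paley (i : color k) v :
  (0 < i)%N -> exists f : pair_class k w -> F,
  forall u t, Mgraph k w i v u -> Mgraph k w i v t -> u != t ->
  forall j : color k, Mgraph k w j u t = (f t - f u \in power_class k w j).
Proof.
move=> i0; have [x xv] := pair_class_repr v.
have [e xe] := cross_basis (pair_class_neq0 xv).
pose s := uval w ^+ i.-1.
pose r (u : pair_class k w) := odflt x [pick y in val u | cross x y == s].
have rP u : Mgraph k w i v u -> r u \in val u /\ cross x (r u) = s.
  move=> /(Mgraph_normalize_out i0 xv)[y yu /eqP yE].
  rewrite /r; case: pickP => [z /andP[zu /eqP zE] //|/(_ y)].
  by rewrite yu yE.
exists (fun u => s * cross e (r u)) => u t /rP[ru su] /rP[rt st] ut j.
rewrite (MgraphE _ ru rt) ut /=.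
by rewrite -[cross (r u) (r t)]mulr1 -xe cross_plucker su st.
Qed.

End Mgraph.

(** * Monochromatic transitive subtournaments of M_k^*(q) *)

Section Mstar.

Variables (F : finFieldType) (k : nat) (w : {unit F}).
Variable T : colored_digraph (color k) (pair_class k w).
Hypothesis TM : is_Mstar k w T.
Variable A : {set pair_class k w}.
Hypotheses (tour : tournament_on T A) (mono : monochromatic_on T A).

Lemma Mstar_color_gt0 j u v : ~~ parallel u v -> T j u v -> (0 < j)%N.
Proof.
rewrite /parallel negb_or => /andP[_ n0]; rewrite (TM.1 _ _ n0) lt0n => Tj.
apply: contraNneq n0 => j0; suff -> : ord0 = j by [].
by apply: val_inj.
Qed.

Lemma Mstar_Mgraph j u v : ~~ parallel u v -> T j u v = Mgraph k w j u v.
Proof. by rewrite /parallel negb_or => /andP[_ n0]; rewrite (TM.1 _ _ n0). Qed.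

Lemma exists_nonparallel v : (0 < k)%N -> generator [set: {unit F}] w ->
  (k < #|A|)%N -> exists2 u, u \in A & ~~ parallel v u.
Proof.
move=> k0 w_gen Ak; apply/subsetPn/negP => sA; move: Ak; rewrite ltnNge.
have sA' : A \subset [set u | parallel v u].
  by apply/subsetP => u /(subsetP sA); rewrite inE.
by rewrite (leq_trans (subset_leq_card sA')) // card_parallel.
Qed.

(** The edge between u and v is inherited from M_k(q), where color 0 is confined
to parallel vertices; so the common color i of A is nonzero. *)
Lemma mono_nonparallel u v : u \in A -> v \in A -> ~~ parallel u v ->
  exists2 i : color k, (0 < i)%N &
  {in A &, forall x y, ~~ parallel x y -> edge T x y = Mgraph k w i x y}.
Proof.
move=> uA vA uv; have [i iP] := mono.
have edgeT : {in A &, forall x y, edge T x y = T i x y}.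
  move=> x y xA yA; apply/existsP/idP => [[j Tj]|]; last by exists i.
  by rewrite -(iP j x y).
have [_ /(_ u v uA vA) tot _] := tour.
exists i; last by move=> x y xA yA xy; rewrite edgeT // Mstar_Mgraph.
have /tot : u != v by apply: contraNneq uv => ->; rewrite /parallel eqxx.
rewrite !edgeT //; case: (boolP (T i u v)) => [Tuv _|_ Tvu].
  exact: Mstar_color_gt0 uv Tuv.
by apply: Mstar_color_gt0 Tvu; rewrite parallelC.
Qed.

(** If there is a vertex u of A outside a parallel class, this class meets A in
at most one out-neighbor and at most one in-neighbor of u. *)
Lemma card_parallel_mono v : (0 < k)%N -> generator [set: {unit F}] w ->
  (k < #|A|)%N -> v \in A -> (#|[set u in A | parallel v u]| <= 2)%N.
Proof.
move=> k0 w_gen Ak vA; have [u uA vu] := exists_nonparallel v k0 w_gen Ak.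
have [i i0 edgeE] := mono_nonparallel vA uA vu.
have [_ tot _] := tour.
set P := [set _ in _ | _].
have PA x : x \in P -> x \in A by rewrite inE => /andP[].
have Pu x : x \in P -> ~~ parallel x u.
  rewrite inE => /andP[_ vx]; apply: contra vu; exact: parallel_trans.
have Pu' x : x \in P -> ~~ parallel u x by rewrite parallelC; apply: Pu.
have PP x y : x \in P -> y \in P -> parallel x y.
  rewrite !inE parallelC => /andP[_ xv] /andP[_ vy].
  exact: parallel_trans xv vy.
(* Split the class into out-neighbors and in-neighbors of u. *)
rewrite -(cardsID [set x | edge T u x] P) -[leqRHS]/(1 + 1)%N.
apply: leq_add; apply/card_le1_eqP => x y.
  rewrite !in_setI => /andP[xP +] /andP[yP]; rewrite !in_set => ux uy.
  rewrite !(edgeE u) ?Pu' ?(PA x) ?(PA y) // in ux uy.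
  exact: parallel_out_inj i0 uy ux (PP _ _ yP xP).
have side z : z \in P -> z \notin [set x | edge T u x] -> Mgraph k w i z u.
  move=> zP; rewrite in_set => uz; rewrite -edgeE ?Pu ?(PA z) //.
  have := tot z u (PA _ zP) uA; rewrite (negPf uz) addbF; apply.
  by apply: contraNneq (Pu _ zP) => ->; rewrite /parallel eqxx.
rewrite !in_setD => /andP[xu xP] /andP[yu yP].
exact: parallel_in_inj i0 (side _ yP yu) (side _ xP xu) (PP _ _ yP xP).
Qed.

End Mstar.

Theorem theorem4p2 (k q m : nat) (F : finFieldType) (w : {unit F})
    (hk : (2 <= k)%N) (hk_even : ~~ odd k)
    (hF : #|F| = q) (hq : q = k + 1 %[mod 2 * k])
    (hw : generator [set: {unit F}] w)
    (hm : (k <= m)%N)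
    (hP : ~ has_mono_trans_subtournament (paley k w) m)
    (T : colored_digraph (color k) (pair_class k w))
    (hT : is_Mstar k w T) :
  ~ has_mono_trans_subtournament T (m + 2).
Proof.
case=> A [Am tour mono tr]; apply: hP.
have k0 : (0 < k)%N by apply: ltnW.
have Ak : (k < #|A|)%N by rewrite Am addn2 ltnS leqW.
have [|v vA src] := transitive_source _ tour tr.
  by rewrite -card_gt0 (leq_trans _ Ak).
have [u uA vu] := exists_nonparallel v k0 hw Ak.
have [i i0 edgeE] := mono_nonparallel hT tour mono vA uA vu.
(* The class of v takes away at most v itself and one more vertex. *)
pose N := [set x in A | ~~ parallel v x].
have Nm : (m <= #|N|)%N.
  have := card_parallel_mono hT tour mono k0 hw Ak vA.
  have := cardsID [set x | parallel v x] A; rewrite Am.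
  have -> : A :\: [set x | parallel v x] = N.
    by apply/setP => x; rewrite !inE andbC.
  rewrite -setIdE => cardA le2.
  by rewrite -(leq_add2r 2) -cardA addnC leq_add2l.
have [s [s_uniq s_size sN]] := card_geqP Nm.
pose B := [set x in s].
have BN x : x \in B -> x \in A /\ ~~ parallel v x.
  by rewrite inE => /sN; rewrite inE => /andP[].
have BA : {subset B <= A} by move=> x /BN[].
have vB x : x \in B -> Mgraph k w i v x.
  move=> /BN[xA vx]; rewrite -edgeE //; apply: src => //.
  by apply: contraNneq vx => ->; rewrite /parallel eqxx.
have npar x y : x \in B -> y \in B -> x != y -> ~~ parallel x y.
  move=> xB yB; apply: contra => xy.
  by apply/eqP; apply: parallel_out_inj i0 (vB x xB) (vB y yB) xy.
have [f fE] := Mgraph_out_paley v i0.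
have <- : #|B| = m by rewrite -s_size cardsE; apply/card_uniqP.
have f_inj : {in B &, injective f}.
  move=> x y xB yB fxy; apply: contraTeq isT => xy.
  have := npar x y xB yB xy; rewrite /parallel negb_or => /andP[_].
  by rewrite (fE x y (vB x xB) (vB y yB) xy) fxy subrr inE eqxx.
(* The vertices of B are pairwise non-parallel, so T agrees with M_k(q) there, and
color 0 occurs on neither side. *)
apply: (mono_trans_embedding BA f_inj _ tour mono tr) => x y xB yB j.
case: (eqVneq x y) => [<-|xy].
  have [/(_ x (BA x xB)) /existsPn/(_ j)/negPf-> _ _] := tour.
  rewrite /paley subrr; apply/negbTE/negP => /andP[j0].
  by apply/negP; apply: power_class_neq0.
rewrite (Mstar_Mgraph hT _ (npar x y xB yB xy)).
rewrite /paley -(fE x y (vB x xB) (vB y yB) xy).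
case: (boolP (Mgraph k w j x y)) => [Mxy|]; last by rewrite andbF.
rewrite andbT; apply: (Mstar_color_gt0 hT (npar x y xB yB xy)).
by rewrite (Mstar_Mgraph hT _ (npar x y xB yB xy)).
Qed.
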